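(* Let $G_1$ and $G_2$ be graphs and let $k$ be a positive integer. If both $G_1$ and $G_2$ are equitably $k$-colorable, then $G_1\Box G_2$ is also equitably $k$-colorable.
   Context: All graphs are finite, loopless, and without multiple edges. The square (Cartesian) product $G_1\Box G_2$ of $G_1=(V_1,E_1)$ and $G_2=(V_2,E_2)$ has vertex set $V_1\times V_2$, and $\{(u,x),(v,y)\}$ is an edge if and only if ($u=v$ and $xy\in E_2$) or ($x=y$ and $uv\in E_1$). A proper $k$-coloring of $G$ is a function $c:V(G)\to\{0,1,\ldots,k-1\}$ mapping adjacent vertices to distinct numbers; its color classes are $V_i=c^{-1}(i)$, $0\leqslant i\leqslant k-1$. $G$ is equitably $k$-colorable if it has a proper $k$-coloring whose color classes satisfy $\big||V_i|-|V_j|\big|\leqslant 1$ for all $i,j\in\{0,\ldots,k-1\}$. *)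

(* Defs.v *)
From mathcomp Require Import all_boot all_order all_algebra.

Set Implicit Arguments.
Unset Strict Implicit.
Unset Printing Implicit Defensive.

(* The vertex set may be empty. *)
Record graph := Graph {
  vertex :> finType;
  adj : rel vertex;
  adj_sym : symmetric adj;
  adj_irrefl : irreflexive adj
}.

Section SquareProduct.
Variables G1 G2 : graph.

Definition square_adj : rel (G1 * G2)%type := fun p q =>
  ((p.1 == q.1) && adj p.2 q.2) || ((p.2 == q.2) && adj p.1 q.1).

Lemma square_adj_sym : symmetric square_adj.
Proof.
move=> p q; rewrite /square_adj.
by rewrite (eq_sym p.1) (eq_sym p.2) (adj_sym p.2) (adj_sym p.1).
Qed.

Lemma square_adj_irrefl : irreflexive square_adj.
Proof. by move=> p; rewrite /square_adj !adj_irrefl !andbF. Qed.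

Definition square_product : graph := Graph square_adj_sym square_adj_irrefl.

End SquareProduct.

Definition proper_coloring (G : graph) (k : nat) (c : G -> 'I_k) : Prop :=
  forall x y : G, adj x y -> c x != c y.

Definition color_class (G : graph) (k : nat) (c : G -> 'I_k) (i : 'I_k) :
  {set G} := [set x | c x == i].

(* Cardinals are cast to [int] because subtraction on [nat] is truncated. *)
Definition equitably_colorable (G : graph) (k : nat) : Prop :=
  exists c : G -> 'I_k, proper_coloring c /\
    forall i j : 'I_k,
      (`| #|color_class c i|%:Z - #|color_class c j|%:Z | <= 1 :> int)%R.

(* Main.v *)
Require Import Defs.
From mathcomp Require Import all_boot all_order all_algebra.
From mathcomp Require Import all_fingroup zify.

(** Recolor each factor by a permutation of the colors and give [(u, x)] the
    color [c2 x - c1 u] modulo [k]. An edge of the product changes exactly one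
    of the two terms, so this is proper for every choice of the permutations;
    they matter only for the sizes of the classes. Color [i] is used
    [\sum_a A a * B (i + a)] times, where [A] and [B] list the class sizes of
    [c1] and [c2], and not every arrangement makes this balanced: if both
    factors have their large classes first, pairs of large classes can pile up
    on the same colors.

    The remedy is to put the large classes of [c1] first and to spread those of
    [c2] as evenly as possible around the cycle of colors: with [n2] vertices
    in the second factor, [B j] is the increment at [j] of
    [F j = floor (j * n2 / k)]. This [B] is [k]-periodic, and its sum over any
    [r] consecutive indices telescopes to [F (i + r) - F i], which is
    [floor (r * n2 / k)] up to a carry of 0 or 1. Writing the order of the first
    factor as [q * k + r], color [i] is used [q * n2 + F (i + r) - F i] times,
    so the carry is the only way in which two class sizes can differ
    ([equidistributed_convolution]).

    Both arrangements are available because a balanced vector is determined up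
    to permutation by its length and its sum ([balanced_perm]), so an equitable
    coloring realizes every balanced vector of sizes with the right total
    ([recolor_with_sizes]). *)

(** * Balanced vectors *)

Definition balanced (k : nat) (s : 'I_k -> nat) : Prop :=
  forall i j, s i <= (s j).+1.

Lemma normz_distn_le1 (m n : nat) :
  (`| m%:Z - n%:Z | <= 1 :> int)%R <-> m <= n.+1 /\ n <= m.+1.
Proof. by split; lia. Qed.

Lemma balanced_between (k m : nat) (s : 'I_k -> nat) :
  (forall i, m <= s i <= m.+1) -> balanced _ s.
Proof. by move=> hs i j; move: (hs i) (hs j); lia. Qed.

(** Entries within one of each other stay within one of their mean: comparing
    [s i] with every other entry bounds its distance to the mean by [k / k.+1],
    which is less than one. *)
Lemma balanced_bounds (k : nat) (s : 'I_k.+1 -> nat) (i : 'I_k.+1) :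
  balanced _ s ->
  let q := (\sum_j s j) %/ k.+1 in q <= s i <= q.+1.
Proof.
move=> hs; set n := \sum_j s j => /=.
have hlo : n <= k.+1 * s i + k.
  rewrite /n (bigD1 i) //= mulSn -addnA leq_add2l.
  apply: (@leq_trans (\sum_(j | j != i) (s i).+1)).
    by apply: leq_sum => j _; apply: hs.
  by rewrite sum_nat_const cardC1 card_ord /= mulnS addnC.
have hhi : s i * k.+1 <= n + k.
  rewrite /n (bigD1 i) //= mulnS -addnA leq_add2l.
  apply: (@leq_trans (\sum_(j | j != i) (s j).+1)).
    rewrite -[k in _ * k]/(k.+1.-1) -[in X in _ * X](card_ord k.+1).
    rewrite -(cardC1 i) mulnC -sum_nat_const.
    by apply: leq_sum => j _; apply: hs.
  under eq_bigr do rewrite -addn1.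
  by rewrite big_split /= sum_nat_const cardC1 card_ord muln1.
apply/andP; split.
  by rewrite -ltnS ltn_divLR // mulSn; lia.
have := leq_div2r k.+1 hhi; rewrite mulnK // => /leq_trans; apply.
rewrite -ltnS ltn_divLR //.
by have := ltn_ceil n (ltn0Sn k); lia.
Qed.

(** A value in [{q, q+1}] contributes its excess over [q] to the sum, so the
    length and the sum give the multiplicities of both values. *)
Lemma perm_two_valued (q : nat) (s t : seq nat) :
  all (fun x => q <= x <= q.+1) s -> all (fun x => q <= x <= q.+1) t ->
  size s = size t -> sumn s = sumn t -> perm_eq s t.
Proof.
have cnt u : all (fun x => q <= x <= q.+1) u ->
    sumn u = q * size u + count_mem q.+1 u /\
    size u = count_mem q u + count_mem q.+1 u.
  elim: u => [|x u IH] /=; first by rewrite muln0.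
  move=> /andP[hx /IH[h1 h2]]; rewrite mulnS h1 {}h2.
  move: (count_mem q u) (count_mem q.+1 u) (q * _) => a b m.
  have [->|->] : x = q \/ x = q.+1 by move: hx; lia.
    by rewrite eqxx (ltn_eqF (ltnSn q)) /=; lia.
  by rewrite eqxx (gtn_eqF (ltnSn q)) /=; lia.
move=> hs ht esz esum.
have [s1 s2] := cnt s hs; have [t1 t2] := cnt t ht.
have other u v : all (fun x => q <= x <= q.+1) u -> v != q -> v != q.+1 ->
    count_mem v u = 0.
  by move=> /allP hu vq vq1; apply/count_memPn/negP => /hu; lia.
have eq1 : count_mem q.+1 s = count_mem q.+1 t.
  by apply: (@addnI (q * size s)); rewrite -s1 esum t1 esz.
have eq0 : count_mem q s = count_mem q t.
  by apply: (@addIn (count_mem q.+1 s)); rewrite -s2 esz t2 eq1.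
apply/allP => v _ /=; apply/eqP.
have [->//|vq] := eqVneq v q; have [->//|vq1] := eqVneq v q.+1.
by rewrite !other.
Qed.

Lemma balanced_perm (k : nat) (s t : 'I_k.+1 -> nat) :
  balanced _ s -> balanced _ t -> \sum_i s i = \sum_i t i ->
  exists p : 'S_k.+1, forall i, t i = s (p i).
Proof.
move=> hs ht est.
have two (u : 'I_k.+1 -> nat) : balanced _ u -> \sum_i u i = \sum_i s i ->
    all (fun x => (\sum_i s i) %/ k.+1 <= x <= ((\sum_i s i) %/ k.+1).+1)
      [tuple u i | i < k.+1].
  move=> hu eu; apply/allP => x /tnthP[i ->]; rewrite tnth_mktuple -eu.
  exact: (balanced_bounds _ _ _ hu).
have sumt (u : 'I_k.+1 -> nat) : sumn [tuple u i | i < k.+1] = \sum_i u i.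
  rewrite sumnE big_tuple; apply: eq_bigr => i _.
  by rewrite tnth_mktuple.
have : perm_eq [tuple t i | i < k.+1] [tuple s i | i < k.+1].
  by apply: perm_two_valued (two _ ht _) (two _ hs _) _ _;
    rewrite ?size_tuple ?sumt.
move=> /tuple_permP[p ep]; exists p => i.
have/val_inj/(congr1 (fun w => tnth w i)) := ep.
by rewrite !tnth_mktuple.
Qed.

(** * Prescribing the sizes of the color classes *)

Lemma sum_card_color_class (G : graph) (k : nat) (c : G -> 'I_k) :
  \sum_i #|color_class c i| = #|G|.
Proof.
rewrite -sum1_card (partition_big c predT) //=.
by apply: eq_bigr => i _; rewrite sum1dep_card; apply: eq_card => x;
  rewrite !inE.
Qed.

(** Permuting the colors keeps a coloring proper and permutes the sizes of its
    classes, and any two balanced vectors with the same total are permutations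
    of each other. *)
Lemma recolor_with_sizes (G : graph) (k : nat) (s : 'I_k.+1 -> nat) :
  equitably_colorable G k.+1 -> balanced _ s -> \sum_i s i = #|G| ->
  exists c : G -> 'I_k.+1,
    proper_coloring c /\ forall i, #|color_class c i| = s i.
Proof.
move=> [c [cP ceq]] hs es.
have hc : balanced _ (fun i => #|color_class c i|).
  by move=> i j; case/(normz_distn_le1 _ _): (ceq i j).
have [|p hp] := balanced_perm _ _ _ hc hs.
  by rewrite sum_card_color_class es.
exists (fun x => (p^-1)%g (c x)); split=> [x y /cP|i].
  by rewrite (inj_eq perm_inj).
rewrite hp; apply: eq_card => x.
by rewrite !inE -(inj_eq (@perm_inj _ p)) permKV.
Qed.

(** * Two arrangements with a balanced cyclic correlation *)

Definition front_sizes (k n j : nat) : nat := n %/ k + (j < n %% k).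

(** Increments of the floors of [j * n / k]: the large classes are spread as
    evenly as possible around the cycle of colors. *)
Definition spread_sizes (k n j : nat) : nat := (j.+1 * n) %/ k - (j * n) %/ k.

Lemma front_sizes_balanced (k n : nat) :
  balanced _ (fun i : 'I_k => front_sizes k n i).
Proof.
by apply: (@balanced_between _ (n %/ k)) => i; rewrite /front_sizes; lia.
Qed.

Lemma sum_front_weighted (k n : nat) (f : nat -> nat) :
  \sum_(a < k.+1) front_sizes k.+1 n a * f a =
  n %/ k.+1 * \sum_(a < k.+1) f a + \sum_(a < n %% k.+1) f a.
Proof.
under eq_bigr do rewrite mulnDl.
rewrite big_split /= -big_distrr /=; congr (_ + _).
rewrite (big_ord_widen k.+1 f) ?[RHS]big_mkcond /=; last first.
  by rewrite ltnW // ltn_pmod.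
by apply: eq_bigr => a _; case: ifP; rewrite ?mul1n ?mul0n.
Qed.

Lemma sum_front_sizes (k n : nat) :
  \sum_(a < k.+1) front_sizes k.+1 n a = n.
Proof.
under eq_bigr do rewrite -[front_sizes _ _ _]muln1.
rewrite (sum_front_weighted k n (fun=> 1)) !sum1_card !card_ord.
by rewrite -divn_eq.
Qed.

Lemma sum_spread_window (k n i r : nat) :
  \sum_(a < r) spread_sizes k n (i + a) =
  ((i + r) * n) %/ k - (i * n) %/ k.
Proof.
have mono j l : j <= l -> (j * n) %/ k <= (l * n) %/ k.
  by move=> jl; rewrite leq_div2r // leq_mul2r jl orbT.
elim: r => [|r IH]; first by rewrite big_ord0 addn0 subnn.
rewrite big_ord_recr /= IH /spread_sizes addnS.
by have := mono _ _ (leqnSn (i + r)); have := mono _ _ (leq_addr r i); lia.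
Qed.

(** The telescoped difference is a floor of a sum minus the floor of one of its
    terms, so it is the floor of the other term up to a carry. *)
Lemma spread_window_bounds (k n i r : nat) : 0 < k ->
  let m := (r * n) %/ k in
  m <= \sum_(a < r) spread_sizes k n (i + a) <= m.+1.
Proof.
move=> k0 /=; rewrite sum_spread_window mulnDl divnD //.
by rewrite -addnA addKn; lia.
Qed.

Lemma spread_sizes_balanced (k n : nat) : 0 < k ->
  balanced _ (fun i : 'I_k => spread_sizes k n i).
Proof.
move=> k0; apply: (@balanced_between _ (n %/ k)) => i.
(* A single size is a window of length one. *)
have := spread_window_bounds k n i 1 k0.
by rewrite big_ord_recl big_ord0 !addn0 mul1n.
Qed.

Lemma sum_spread_period (k n i : nat) :
  \sum_(a < k.+1) spread_sizes k.+1 n (i + a) = n.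
Proof.
by rewrite sum_spread_window mulnDl [k.+1 * n]mulnC addnC divnMDl ?addnK.
Qed.

Lemma spread_sizes_mod (k n j : nat) :
  spread_sizes k.+1 n (j %% k.+1) = spread_sizes k.+1 n j.
Proof.
rewrite {2}(divn_eq j k.+1) /spread_sizes -addnS !mulnDl.
by rewrite ![_ * k.+1 * n]mulnAC !divnMDl // subnDl.
Qed.

(** Split the front vector into the constant [n1 %/ k] and the indicator of the
    first [n1 %% k] colors: the constant sees a whole period of the spread
    vector, whatever [i] is, and the indicator sees one window of fixed
    length. *)
Lemma equidistributed_convolution (k n1 n2 : nat) :
  balanced _ (fun i : 'I_k.+1 =>
    \sum_(a < k.+1) front_sizes k.+1 n1 a * spread_sizes k.+1 n2 (i + a)%R).
Proof.
apply: (@balanced_between _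
  (n1 %/ k.+1 * n2 + (n1 %% k.+1 * n2) %/ k.+1)) => i.
under eq_bigr do rewrite spread_sizes_mod.
rewrite (sum_front_weighted k n1 (fun a => spread_sizes k.+1 n2 (i + a))).
rewrite sum_spread_period -addnS !leq_add2l.
exact: spread_window_bounds.
Qed.

(** * Coloring the product *)

Definition difference_coloring (G1 G2 : graph) (k : nat)
    (c1 : G1 -> 'I_k.+1) (c2 : G2 -> 'I_k.+1) :
  square_product G1 G2 -> 'I_k.+1 := fun p => (c2 p.2 - c1 p.1)%R.

Lemma difference_coloring_proper (G1 G2 : graph) (k : nat)
    (c1 : G1 -> 'I_k.+1) (c2 : G2 -> 'I_k.+1) :
  proper_coloring c1 -> proper_coloring c2 ->
  proper_coloring (difference_coloring _ _ _ c1 c2).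
Proof.
move=> c1P c2P [u x] [v y] /= /orP[] /andP[/= /eqP -> e].
  rewrite /difference_coloring /= (inj_eq (GRing.addIr _)); exact: c2P.
rewrite /difference_coloring /= (inj_eq (GRing.addrI _)).
rewrite (inj_eq GRing.oppr_inj); exact: c1P.
Qed.

Lemma card_difference_class (G1 G2 : graph) (k : nat)
    (c1 : G1 -> 'I_k.+1) (c2 : G2 -> 'I_k.+1) (i : 'I_k.+1) :
  #|color_class (difference_coloring _ _ _ c1 c2) i| =
  \sum_a #|color_class c1 a| * #|color_class c2 (i + a)%R|.
Proof.
rewrite -sum1_card (partition_big (fun p => c1 p.1) predT) //=.
apply: eq_bigr => a _; rewrite sum1dep_card -cardsX.
apply: eq_card => -[u x]; rewrite !inE /difference_coloring /= andbC.
by have [->|//] := eqVneq (c1 u) a; rewrite GRing.subr_eq.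
Qed.

Theorem theorem4 (G1 G2 : graph) (k : nat) (hk : 0 < k)
  (h1 : equitably_colorable G1 k) (h2 : equitably_colorable G2 k) :
  equitably_colorable (square_product G1 G2) k.
Proof.
case: k hk h1 h2 => // k _ h1 h2.
have [c1 [c1P s1]] :=
  recolor_with_sizes _ _ _ h1 (front_sizes_balanced _ #|G1|)
    (sum_front_sizes _ _).
have [c2 [c2P s2]] :=
  recolor_with_sizes _ _ _ h2 (spread_sizes_balanced _ #|G2| (ltn0Sn k))
    (sum_spread_period _ _ 0).
exists (difference_coloring _ _ _ c1 c2); split.
  exact: difference_coloring_proper.
have card_class l : #|color_class (difference_coloring _ _ _ c1 c2) l| =
    \sum_(a < k.+1)
      front_sizes k.+1 #|G1| a * spread_sizes k.+1 #|G2| (l + a)%R.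
  by rewrite card_difference_class; under eq_bigr do rewrite s1 s2.
have bal := equidistributed_convolution k #|G1| #|G2|.
by move=> i j; apply/normz_distn_le1; rewrite !card_class; split; apply: bal.
Qed.
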